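(* Fix an equation $(f,q,w)$ as in the context. Let $\gamma\in(-\pi,\pi]$ and $K=(k_{ij})\in SL(2,\mathbb R)$ with $k_{11}-f_0k_{12}\neq0$. If $k_{11}\neq0$ let $\widehat K=\begin{pmatrix}k_{11}&k_{11}/f_0\\k_{21}&(f_0+k_{11}k_{21})/(k_{11}f_0)\end{pmatrix}$; if $k_{12}\neq0$ let $\widetilde K=\begin{pmatrix}f_0k_{12}&k_{12}\\(f_0k_{12}k_{22}-1)/k_{12}&k_{22}\end{pmatrix}$. Write $\lambda_n(e^{i\gamma}L)$ for the eigenvalues with boundary condition $[e^{i\gamma}L|-I]$. Then the problem with $[e^{i\gamma}K|-I]$ has exactly $N$ eigenvalues and the problems with $[e^{i\gamma}\widehat K|-I]$ and $[e^{i\gamma}\widetilde K|-I]$ (when defined) have exactly $N-1$ eigenvalues. Moreover: (i) if $k_{11}\ne0$, then $\lambda_n(e^{i\gamma}K)\le\lambda_n(e^{i\gamma}\widehat K)\le\lambda_{n+1}(e^{i\gamma}K)$ for $0\le n\le N-2$; (ii) if $k_{12}\neq0$, then $\lambda_n(e^{i\gamma}K)\le\lambda_n(e^{i\gamma}\widetilde K)\le\lambda_{n+1}(e^{i\gamma}K)$ for $0\le n\le N-2$.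
   Context: Let $N\ge2$ be an integer. An equation is given by real sequences $f=\{f_n\}_{n=0}^N$, $q=\{q_n\}_{n=1}^N$, $w=\{w_n\}_{n=1}^N$ with $f_n\neq0$, $w_n>0$; it is $-\nabla(f_n\Delta y_n)+q_ny_n=\lambda w_ny_n$, $1\le n\le N$, for $y=\{y_n\}_{n=0}^{N+1}$, $\Delta y_n=y_{n+1}-y_n$, $\nabla y_n=y_n-y_{n-1}$. The boundary condition $[A\,|\,B]$ is $A(y_0,f_0\Delta y_0)^T+B(y_N,f_N\Delta y_N)^T=0$. $SL(2,\mathbb R)$: real $2\times2$ matrices of determinant 1; $I$ the identity. Eigenvalues ($\lambda$ with a nontrivial solution) are real; multiplicity = dimension of the solution space (equal to the multiplicity as a zero of the characteristic polynomial); counted with multiplicity they are ordered $\lambda_0\le\lambda_1\le\cdots$, and ''exactly $k$ eigenvalues'' counts multiplicity. *)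

(* Defs.v *)
From HB Require Import structures.
From mathcomp Require Import all_boot all_order all_algebra.
From mathcomp Require Import all_classical all_reals.
From mathcomp Require Import trigo.
From mathcomp Require Import complex.
Set Implicit Arguments. Unset Strict Implicit. Unset Printing Implicit Defensive.
Import Order.TTheory GRing.Theory Num.Theory.
Local Open Scope ring_scope.

Definition mx2 (T : Type) (a b c d : T) : 'M[T]_2 :=
  \matrix_(i < 2, j < 2)
    (if (i : nat) == 0%N then (if (j : nat) == 0%N then a else b)
     else (if (j : nat) == 0%N then c else d)).

Definition col2 (T : Type) (a b : T) : 'cV[T]_2 :=
  \col_(i < 2) (if (i : nat) == 0%N then a else b).

(* The linear system of the boundary value problem
     -nabla(f_n Delta y_n) + q_n y_n = mu w_n y_n   (1 <= n <= N),
     A (y_0, f_0 Delta y_0)^T + B (y_N, f_N Delta y_N)^T = 0,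
   acting on y = (y_0, ..., y_{N+1}) (a row vector of length N+2, entry k is y_k).
   Output entry 0 and N+1 are the two boundary equations, entry n (1<=n<=N)
   is the n-th difference equation; y is a solution iff sys y = 0. *)
Definition bvp_sys (R : rcfType) (N : nat) (f q w : nat -> R) (A B : 'M[R[i]]_2)
  (mu : R[i]) (y : 'rV[R[i]]_(N.+2)) : 'rV[R[i]]_(N.+2) :=
  let yk k := y 0 (inord k) in
  let fc k := (f k)%:C%C in
  let D k := yk k.+1 - yk k in
  let bc := A *m col2 (yk 0%N) (fc 0%N * D 0%N) + B *m col2 (yk N) (fc N * D N) in
  \row_(j < N.+2)
    (if (j : nat) == 0%N then bc 0 0
     else if (j : nat) == N.+1 then bc 1 0
     else - (fc j * D j - fc j.-1 * D j.-1) + (q j)%:C%C * yk j - mu * (w j)%:C%C * yk j).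

Arguments bvp_sys {R} N f q w A B mu y.

Definition bvp_mult (R : rcfType) (N : nat) (f q w : nat -> R) (A B : 'M[R[i]]_2)
  (mu : R[i]) : nat :=
  \rank (kermx (lin1_mx (bvp_sys N f q w A B mu))).

(* lam is the list of all eigenvalues, counted with multiplicity, in
   nondecreasing order: lam`_n = lambda_n. *)
Definition bvp_spectrum (R : rcfType) (N : nat) (f q w : nat -> R) (A B : 'M[R[i]]_2)
  (lam : seq R) : Prop :=
  sorted <=%R lam /\
  forall mu : R[i], bvp_mult N f q w A B mu = count (fun x : R => x%:C%C == mu) lam.

Definition Aexp (R : realType) (gamma : R) (L : 'M[R]_2) : 'M[R[i]]_2 :=
  (cos gamma +i* sin gamma)%C *: map_mx (fun x : R => x%:C%C) L.
Definition Bneg (R : rcfType) : 'M[R[i]]_2 := - 1%:M.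
Arguments Bneg {R}.

Definition Khat (R : fieldType) (f0 : R) (K : 'M[R]_2) : 'M[R]_2 :=
  mx2 (K 0 0) (K 0 0 / f0) (K 1 0) ((f0 + K 0 0 * K 1 0) / (K 0 0 * f0)).
Definition Ktilde (R : fieldType) (f0 : R) (K : 'M[R]_2) : 'M[R]_2 :=
  mx2 (f0 * K 0 1) (K 0 1) ((f0 * K 0 1 * K 1 1 - 1) / K 0 1) (K 1 1).

(* Main.v *)
Require Import Defs.
From HB Require Import structures.
From mathcomp Require Import all_boot all_order all_algebra.
From mathcomp Require Import all_classical all_reals.
From mathcomp Require Import trigo.
From mathcomp Require Import complex.
From mathcomp Require Import perm sesquilinear spectral ring.
Set Implicit Arguments. Unset Strict Implicit. Unset Printing Implicit Defensive.
Import Order.TTheory GRing.Theory Num.Theory.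
Local Open Scope ring_scope.
Local Open Scope sesquilinear_scope.

(** Write [z = exp (i gamma)] and [c = k11 - f0 k12].  As [c != 0], the boundary
    condition of [K] expresses [y_0] and [y_(N+1)] through [y_1] and [y_N], and
    [det K = 1] makes the remaining problem on [(y_1, ..., y_N)] a pencil
    [A - mu W] with [W] the positive diagonal matrix of the weights and [A] a
    Hermitian Jacobi matrix with two extra corner entries [- f0 / c * z] and its
    conjugate.

    For both hatted matrices [L] one has [l11 = f0 l12], so that their first
    boundary condition is the constraint [y_N = z l11 y_1]; eliminating [y_0]
    between the first and the last difference equation yields exactly the
    compression of the pencil of [K] to this hyperplane.  The compression of [W]
    is again diagonal, and Cauchy interlacing concludes. *)

(** * Hermitian pencils and interlacing *)

Lemma mulmx_trC (C : numClosedFieldType) (m n p : nat)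
    (A : 'M[C]_(m, n)) (B : 'M[C]_(n, p)) :
  (A *m B)^t* = B^t* *m A^t*.
Proof. by rewrite trmx_mul map_mxM. Qed.

Lemma conjC_real_complex (R : rcfType) (x : R) :
  (x%:C%C : R[i])^* = x%:C%C.
Proof. exact: conjc_real. Qed.

(** With [S] the diagonal matrix of the $w_i^{-1/2}$, the pair reduces to the single Hermitian
    matrix [S *m A *m S], to which the spectral theorem applies. Multiplying the unitary eigenvector
    matrix by [S] makes its rows orthonormal for the weight; a permutation of them sorts the
    eigenvalues. *)
Lemma hermitian_pair_diagonalization (R : rcfType) (n : nat) (w : 'I_n -> R)
    (A : 'M[R[i]]_n) :
  (forall i, 0 < w i) -> A^t* = A ->
  exists (lam : n.-tuple R) (P : 'M[R[i]]_n),
    [/\ sorted <=%R lam,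
        P *m diag_mx (\row_i (w i)%:C%C) *m P^t* = 1%:M &
        P *m A *m P^t* = diag_mx (\row_i (tnth lam i)%:C%C)].
Proof.
move=> w_gt0 hA.
pose s i : R[i] := (Num.sqrt (w i))^-1%:C%C.
have sreal i : (s i)^* = s i by rewrite conjC_real_complex.
have sK i : s i * (w i)%:C%C * s i = 1.
  rewrite -!rmorphM /= -{2}(@sqr_sqrtr _ (w i)) ?ltW // expr2.
  by rewrite !mulrA mulVf ?mul1r ?mulfV // gt_eqF ?sqrtr_gt0.
pose S : 'M[R[i]]_n := diag_mx (\row_i s i).
have hS : S^t* = S.
  apply/matrixP => i j; rewrite !mxE rmorphMn /= sreal eq_sym.
  by case: eqP => [->|_].
pose B := S *m A *m S.
have hB : B \is hermsymmx.
  apply/is_hermitianmxP; rewrite expr0 scale1r.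
  by rewrite [RHS]mulmx_trC mulmx_trC hS hA mulmxA.
have Bdiag := orthomx_spectralP (hermitian_normalmx hB).
have Breal := hermitian_spectral_diag_real hB.
have Uu := spectral_unitarymx B.
set U := spectralmx B in Bdiag Uu; set d := spectral_diag B in Bdiag Breal.
pose r : n.-tuple R := [tuple complex.Re (d 0 i) | i < n].
have dE i : d 0 i = (tnth r i)%:C%C.
  by rewrite tnth_mktuple RRe_real // (mxOverP Breal).
have [p pE] : exists p : 'S_n, sort <=%R r = [tuple tnth r (p i) | i < n].
  by apply/tuple_permP; rewrite perm_sort.
exists [tuple tnth r (p i) | i < n], (row_perm p (U *m S)).
have UU : U *m U^t* = 1%:M by apply/unitarymxP.
split.
- by rewrite -pE sort_sorted //; apply: le_total.
- have -> : diag_mx (\row_i (w i)%:C%C) = invmx S *m invmx S :> 'M[R[i]]_n.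
    have SD : S *m diag_mx (\row_i (w i)%:C%C) *m S = 1%:M.
      apply/matrixP => i j.
      rewrite mul_mx_diag mxE mul_diag_mx !mxE.
      by case: eqP => [->|_]; rewrite ?mulr1n ?sK ?mulr0n ?mulr0 ?mul0r.
    have Su : S \in unitmx by case/mulmx1_unit: SD.
    by rewrite -[LHS](mulKmx Su) -[X in _ *m X](mulmxK Su) SD mul1mx.
  have Su : S \in unitmx.
    rewrite unitmxE det_diag unitfE prodf_seq_neq0; apply/allP => i _ /=.
    rewrite mxE; apply/eqP => s0; move/eqP: (sK i).
    by rewrite s0 mulr0 eq_sym oner_eq0.
  rewrite row_permE !mulmx_trC hS !mulmxA (mulmxK Su) mulmxKV // -(mulmxA _ U).
  rewrite UU mulmx1 tr_perm_mx map_perm_mx -perm_mxM.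
  by rewrite fingroup.mulgV perm_mx1.
- have UBU : U *m S *m A *m S *m U^t* = diag_mx d.
    transitivity (U *m B *m U^t* ); first by rewrite !mulmxA.
    rewrite [B in U *m B]Bdiag.
    by rewrite !mulmxA mulmxV ?spectral_unit // mul1mx -mulmxA UU mulmx1.
  rewrite row_permE !mulmx_trC hS !mulmxA.
  rewrite -!(mulmxA (perm_mx p)) -!mulmxA.
  rewrite [X in _ *m X](_ : _ = diag_mx d *m (perm_mx p)^t* ); last first.
    by rewrite -UBU !mulmxA.
  rewrite tr_perm_mx map_perm_mx mulmxA.
  rewrite -row_permE -col_permE; apply/matrixP => i j; rewrite !mxE.
  by rewrite tnth_mktuple dE; congr (_ *+ _); rewrite (inj_eq perm_inj).
Qed.

Lemma mul_diag_trC_ge (R : rcfType) (n : nat) (d : 'I_n -> R) (c : R)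
    (u : 'rV[R[i]]_n) : (forall i, c <= d i) ->
  c%:C%C * (u *m u^t*) 0 0 <= (u *m diag_mx (\row_i (d i)%:C%C) *m u^t*) 0 0.
Proof.
move=> cd; rewrite mul_mx_diag !mxE mulr_sumr; apply: ler_sum => i _.
rewrite !mxE mulrAC [leRHS]mulrC ler_wpM2r ?lecR //.
exact: mul_conjC_ge0.
Qed.

Lemma mul_diag_trC_le (R : rcfType) (n : nat) (d : 'I_n -> R) (c : R)
    (u : 'rV[R[i]]_n) : (forall i, d i <= c) ->
  (u *m diag_mx (\row_i (d i)%:C%C) *m u^t*) 0 0 <= c%:C%C * (u *m u^t*) 0 0.
Proof.
move=> cd; rewrite mul_mx_diag !mxE mulr_sumr; apply: ler_sum => i _.
rewrite !mxE mulrAC mulrC ler_wpM2r ?lecR //.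
exact: mul_conjC_ge0.
Qed.

Lemma mul_trC_eq0 (C : numClosedFieldType) (n : nat) (u : 'rV[C]_n) :
  ((u *m u^t*) 0 0 == 0) = (u == 0).
Proof.
apply/eqP/eqP => [|->]; last by rewrite mul0mx mxE.
rewrite mxE => u0; apply/rowP => i; rewrite [RHS]mxE; apply/eqP.
rewrite -mul_conjC_eq0; apply/eqP.
have := psumr_eq0P _ u0 (i := i) isT; rewrite !mxE; apply=> j _.
by rewrite !mxE mul_conjC_ge0.
Qed.

(* A dimension count makes the row spaces of [X] and [Y] meet; a common vector
   compares the two Rayleigh quotients. *)
Lemma rayleigh_crossing (R : rcfType) (n a b : nat) (W A : 'M[R[i]]_n)
    (X : 'M[R[i]]_(a, n)) (Y : 'M[R[i]]_(b, n))
    (d : 'I_a -> R) (e : 'I_b -> R) (dmax emin : R) :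
  (n < a + b)%N ->
  X *m W *m X^t* = 1%:M -> Y *m W *m Y^t* = 1%:M ->
  X *m A *m X^t* = diag_mx (\row_i (d i)%:C%C) ->
  Y *m A *m Y^t* = diag_mx (\row_i (e i)%:C%C) ->
  (forall i, d i <= dmax) -> (forall i, emin <= e i) -> emin <= dmax.
Proof.
move=> nab XW YW XA YA dle ege.
(* More than [n] rows in dimension [n] satisfy a nontrivial relation [t]; its halves [u] and [v]
   give the common vector [u *m X = - v *m Y]. *)
have /rowV0Pn[t] : kermx (col_mx X Y) != 0.
  rewrite -mxrank_eq0 mxrank_ker -lt0n subn_gt0.
  exact: leq_ltn_trans (rank_leq_col _) nab.
rewrite -[t]hsubmxK; set u := lsubmx t; set v := rsubmx t.
move=> /sub_kermxP; rewrite mul_row_col => /eqP.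
rewrite addr_eq0 -mulNmx => /eqP uv.
have form Q : u *m (X *m Q *m X^t*) *m u^t* = v *m (Y *m Q *m Y^t*) *m v^t*.
  transitivity ((u *m X) *m Q *m (u *m X)^t*); first by rewrite mulmx_trC !mulmxA.
  rewrite uv mulmx_trC [(- v)^T]linearN /= map_mxN !(mulNmx, mulmxN) opprK.
  by rewrite !mulmxA.
(* Both sides are the squared [W]-norm of the common vector. *)
have uuvv : u *m u^t* = v *m v^t*.
  by have := form W; rewrite XW YW !mulmx1.
have := form A; rewrite XA YA => /matrixP/(_ 0 0) fA tN0.
have ve := mul_diag_trC_ge v ege; have ud := mul_diag_trC_le u dle.
rewrite -fA -uuvv in ve; have := le_trans ve ud.
(* The norm divided out is positive: [u = 0] would force [v = 0], hence [t = 0]. *)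
rewrite ler_pM2r ?lecR // lt_def mul_trC_eq0; apply/andP; split.
  apply: contraNneq tN0 => u0; move/eqP: uuvv; rewrite u0 mul0mx eq_sym => vv0.
  have /eqP -> : v == 0 by rewrite -mul_trC_eq0 (eqP vv0) mxE.
  by rewrite row_mx0.
by rewrite mxE sumr_ge0 // => i _; rewrite !mxE mul_conjC_ge0.
Qed.

Lemma rowsub_diagonalization (R : rcfType) (m n a : nat) (A : 'M[R[i]]_n)
    (P : 'M[R[i]]_(m, n)) (d : 'I_m -> R) (g : 'I_a -> 'I_m) : injective g ->
  P *m A *m P^t* = diag_mx (\row_i (d i)%:C%C) ->
  rowsub g P *m A *m (rowsub g P)^t* = diag_mx (\row_i (d (g i))%:C%C).
Proof.
move=> ginj PA.
have -> : (rowsub g P)^t* = colsub g (P^t* ) by apply/matrixP => i j; rewrite !mxE.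
rewrite mul_rowsub_mx mulmx_colsub mul_rowsub_mx PA; apply/matrixP => i j.
by rewrite !mxE (inj_eq ginj).
Qed.

(** The span of the first [k.+1] rows of [P], where the Rayleigh quotient is at most $\lambda_k$,
    meets the span of the last [q - l] rows of [Q], where it is at least $\mu_l$. Leaving [p] and
    [q] free lets one statement serve for both halves of Cauchy interlacing. *)
Lemma eigenvalue_crossing (R : rcfType) (n p q : nat) (W A : 'M[R[i]]_n)
    (P : 'M[R[i]]_(p, n)) (Q : 'M[R[i]]_(q, n))
    (lam : p.-tuple R) (mu : q.-tuple R) (k l : nat) :
  sorted <=%R lam -> sorted <=%R mu ->
  P *m W *m P^t* = 1%:M -> Q *m W *m Q^t* = 1%:M ->
  P *m A *m P^t* = diag_mx (\row_i (tnth lam i)%:C%C) ->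
  Q *m A *m Q^t* = diag_mx (\row_i (tnth mu i)%:C%C) ->
  (k < p)%N -> (l < q)%N -> (n + l < k.+1 + q)%N -> mu`_l <= lam`_k.
Proof.
move=> slam smu PW QW PA QA kp lq nkl.
have one m : 1%:M = diag_mx (\row_(i < m) (1 : R)%:C%C) :> 'M[R[i]]_m.
  by rewrite -[LHS]diag_const_mx; congr diag_mx; apply/rowP => i; rewrite !mxE.
have nth_mono m (t : m.-tuple R) i j :
    sorted <=%R t -> (i <= j)%N -> (j < m)%N -> t`_i <= t`_j.
  move=> st ij jm; apply: (sorted_leq_nth le_trans lexx _ st) => //.
    by rewrite inE size_tuple (leq_ltn_trans ij).
  by rewrite inE size_tuple.
pose g : 'I_k.+1 -> 'I_p := widen_ord kp.
have ginj : injective g by move=> i j /(congr1 val) /= /val_inj.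
pose h (i : 'I_(q - l)) : 'I_q := cast_ord (subnKC (ltnW lq)) (rshift l i).
have hinj : injective h by move=> i j /cast_ord_inj /rshift_inj.
have kql : (n < k.+1 + (q - l))%N 
  by rewrite addnBA ?(ltnW lq) // ltn_subRL addnC.
rewrite one in PW; rewrite one in QW.
apply: (@rayleigh_crossing _ _ _ _ W A (rowsub g P) (rowsub h Q)
         (fun i => tnth lam (g i)) (fun i => tnth mu (h i)) _ _ kql).
- by rewrite (rowsub_diagonalization ginj PW) -one.
- by rewrite (rowsub_diagonalization hinj QW) -one.
- exact: rowsub_diagonalization.
- exact: rowsub_diagonalization.
- by move=> i; rewrite (tnth_nth 0) nth_mono //= -ltnS.
- by move=> i; rewrite (tnth_nth 0) nth_mono //; exact: leq_addr.
Qed.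

Lemma mxrank_diag_mx (F : fieldType) (n : nat) (d : 'rV[F]_n) :
  \rank (diag_mx d) = (\sum_(i < n) (d 0 i != 0)%R)%N.
Proof.
elim: n d => [|n IHn] d; first by rewrite big_ord0 flatmx0 mxrank0.
rewrite -[n.+1]/(1 + n)%N in d *; rewrite -[d]hsubmxK diag_mx_row.
rewrite rank_diag_block_mx IHn big_split_ord big_ord1 /=; congr (_ + _)%N.
  rewrite row_mxEl rank_rV; congr (nat_of_bool (~~ _)).
  apply/eqP/eqP => [/matrixP/(_ 0 0)|d0]; first by rewrite !mxE eqxx.
  by apply/matrixP => i j; rewrite !ord1 mxE d0 !mxE mul0rn.
by apply: eq_bigr => i _; rewrite row_mxEr.
Qed.

(** Congruence by the invertible [P] preserves the rank and turns the pencil into the diagonal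
    matrix of the $\lambda_i-\mu$, whose kernel dimension is its number of zeros. *)
Lemma mxrank_ker_pencil (R : rcfType) (n : nat) (W A P : 'M[R[i]]_n)
    (lam : n.-tuple R) (mu : R[i]) :
  P *m W *m P^t* = 1%:M ->
  P *m A *m P^t* = diag_mx (\row_i (tnth lam i)%:C%C) ->
  \rank (kermx (A - mu *: W)) = count (fun x : R => x%:C%C == mu) lam.
Proof.
move=> PW PA; have [Pu Pu'] : P \in unitmx /\ P^t* \in unitmx.
  have := PW; rewrite -mulmxA => /mulmx1_unit[-> _].
  by case/mulmx1_unit: PW.
pose D : 'M[R[i]]_n := diag_mx (\row_i ((tnth lam i)%:C%C - mu)).
have PD : P *m (A - mu *: W) *m P^t* = D.
  rewrite mulmxBr mulmxBl -scalemxAr -scalemxAl PW PA.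
  by apply/matrixP => i j; rewrite !mxE mulrnBl mulr_natr.
have -> : \rank (kermx (A - mu *: W)) = \rank (kermx D).
  rewrite !mxrank_ker -PD mxrankMfree ?row_free_unit //.
  by rewrite eqmxMfull // row_full_unit.
rewrite mxrank_ker mxrank_diag_mx -sum1_count big_tuple.
rewrite -[X in (X - _)%N]card_ord -sum1_card.
rewrite [X in (X - _)%N](_ : _ = \sum_(i < n)
    ((tnth lam i)%:C%C == mu) + \sum_(i < n) ((tnth lam i)%:C%C != mu))%N; last first.
  by rewrite -big_split; apply: eq_bigr => i _; case: eqP.
under [X in (_ - X)%N]eq_bigr do rewrite mxE subr_eq0.
by rewrite addnK [RHS]big_mkcond; apply: eq_bigr => i _; case: eqP.
Qed.

(** * Reduction of the boundary value problem to sequences *)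

(** [G] restricts to an isomorphism between the left kernels: the second hypothesis is injectivity,
    the other two identify the image. *)
Lemma mxrank_ker_iso (F : fieldType) (m n : nat) (T : 'M[F]_m) (S : 'M[F]_n)
    (G : 'M[F]_(m, n)) :
  (forall y : 'rV_m, y *m T = 0 -> y *m G *m S = 0) ->
  (forall y : 'rV_m, y *m T = 0 -> y *m G = 0 -> y = 0) ->
  (forall x : 'rV_n, x *m S = 0 -> exists2 y, y *m T = 0 & y *m G = x) ->
  \rank (kermx T) = \rank (kermx S).
Proof.
move=> TS Tinj Tsurj; rewrite -(mxrank_mul_ker (kermx T) G).
have /eqP -> : (kermx T :&: kermx G)%MS == 0.
  apply/rowV0P => y; rewrite sub_capmx => /andP[/sub_kermxP yT /sub_kermxP yG].
  exact: Tinj.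
rewrite mxrank0 addn0; apply: eqmx_rank; apply/andP; split; apply/rV_subP => x.
  move=> /submxP[u ->]; apply/sub_kermxP; rewrite mulmxA; apply: TS.
  by rewrite -mulmxA mulmx_ker mulmx0.
move=> /sub_kermxP /Tsurj[y yT <-]; apply: submxMr; exact/sub_kermxP.
Qed.

Definition bvp_eqn (R : rcfType) (f q w : nat -> R) (mu : R[i]) (Y : nat -> R[i])
    (k : nat) : R[i] :=
  - ((f k)%:C%C * (Y k.+1 - Y k) - (f k.-1)%:C%C * (Y k - Y k.-1))
  + (q k)%:C%C * Y k - mu * (w k)%:C%C * Y k.

(** Sequences on all of [nat] replace row vectors, which frees the indices from bounds. Only the
    values at $0,\dots,N+1$ enter, and [k.-1] is never truncated since [0 < k]. *)
Definition bvp_solution (R : rcfType) (N : nat) (f q w : nat -> R) (z : R[i])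
    (L : 'M[R]_2) (mu : R[i]) (Y : nat -> R[i]) : Prop :=
  [/\ z * ((L 0 0)%:C%C * Y 0%N + (L 0 1)%:C%C * ((f 0%N)%:C%C * (Y 1%N - Y 0%N)))
        = Y N,
      z * ((L 1 0)%:C%C * Y 0%N + (L 1 1)%:C%C * ((f 0%N)%:C%C * (Y 1%N - Y 0%N)))
        = (f N)%:C%C * (Y N.+1 - Y N) &
      forall k, (0 < k <= N)%N -> bvp_eqn f q w mu Y k = 0].

Lemma bvp_sys_is_linear (R : rcfType) (N : nat) (f q w : nat -> R)
    (A B : 'M[R[i]]_2) (mu : R[i]) : linear (bvp_sys N f q w A B mu).
Proof.
move=> a u v; apply/rowP => j; rewrite !mxE.
case: ifP => _; first by rewrite !big_ord_recl !big_ord0 !mxE /=; ring.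
case: ifP => _; first by rewrite !big_ord_recl !big_ord0 !mxE /=; ring.
by ring.
Qed.

HB.instance Definition _ (R : rcfType) (N : nat) (f q w : nat -> R)
    (A B : 'M[R[i]]_2) (mu : R[i]) :=
  GRing.isLinear.Build R[i] 'rV[R[i]]_N.+2 'rV[R[i]]_N.+2 _
    (bvp_sys N f q w A B mu) (bvp_sys_is_linear f q w A B mu).

Lemma bvp_sysP (R : realType) (N : nat) (f q w : nat -> R) (gamma : R)
    (L : 'M[R]_2) (mu : R[i]) (y : 'rV[R[i]]_N.+2) :
  y *m lin1_mx (bvp_sys N f q w (Aexp gamma L) Bneg mu) = 0 <->
  bvp_solution N f q w (cos gamma +i* sin gamma)%C L mu (fun k => y 0 (inord k)).
Proof.
rewrite mul_rV_lin1 /=; set z := (_ +i* _)%C.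
have bc0 (Y : nat -> R[i]) : (Aexp gamma L *m col2 (Y 0%N) ((f 0%N)%:C%C * (Y 1%N - Y 0%N))
    + Bneg *m col2 (Y N) ((f N)%:C%C * (Y N.+1 - Y N))) 0 0 =
  z * ((L 0 0)%:C%C * Y 0%N + (L 0 1)%:C%C * ((f 0%N)%:C%C * (Y 1%N - Y 0%N))) - Y N.
  rewrite !mxE !big_ord_recl !big_ord0 !mxE /= -/z.
  by rewrite (_ : lift 0 0 = 1); [ring | apply/val_inj].
have bc1 (Y : nat -> R[i]) : (Aexp gamma L *m col2 (Y 0%N) ((f 0%N)%:C%C * (Y 1%N - Y 0%N))
    + Bneg *m col2 (Y N) ((f N)%:C%C * (Y N.+1 - Y N))) 1 0 =
  z * ((L 1 0)%:C%C * Y 0%N + (L 1 1)%:C%C * ((f 0%N)%:C%C * (Y 1%N - Y 0%N)))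
    - (f N)%:C%C * (Y N.+1 - Y N).
  rewrite !mxE !big_ord_recl !big_ord0 !mxE /= -/z.
  by rewrite (_ : lift 0 0 = 1); [ring | apply/val_inj].
rewrite /bvp_sys (bc0 (fun k => y 0 (inord k))) (bc1 (fun k => y 0 (inord k))).
split=> [/rowP y0|[b0 b1 eqs]].
  split.
  - by have := y0 0; rewrite !mxE /= => /eqP; rewrite subr_eq0 => /eqP.
  - have := y0 ord_max; rewrite !mxE /= eqxx => /eqP; rewrite subr_eq0 => /eqP.
    exact.
  - move=> k /andP[k0 kN]; have := y0 (inord k).
    rewrite !mxE inordK ?ltnS; last exact: leqW.
    by rewrite (gtn_eqF k0) (ltn_eqF (kN : (k < N.+1)%N)) (prednK k0).
apply/rowP => j; rewrite [RHS]mxE mxE.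
have [j0|j0] := posnP j; first by rewrite b0 subrr.
have [jN|jN] := eqVneq (j : nat) N.+1; first by rewrite b1 subrr.
rewrite (prednK j0); apply: eqs; rewrite j0 /=.
by have := ltn_ord j; rewrite ltnS leq_eqVlt (negPf jN).
Qed.

(** The isomorphism keeps the coordinates $y_1,\dots,y_p$ of a solution. It serves with [p = N] for
    [K] and with [p = N - 1] for the singular conditions. *)
Lemma bvp_mult_iso (R : realType) (N p : nat) (f q w : nat -> R) (gamma : R)
    (L : 'M[R]_2) (mu : R[i]) (S : 'M[R[i]]_p)
    (sol := bvp_solution N f q w (cos gamma +i* sin gamma)%C L mu) :
  (p <= N)%N ->
  (forall Y, sol Y -> (\row_(j < p) Y j.+1) *m S = 0) ->
  (forall Y, sol Y -> (forall j, (0 < j <= p)%N -> Y j = 0) ->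
     forall j, (j <= N.+1)%N -> Y j = 0) ->
  (forall x : 'rV_p, x *m S = 0 ->
     exists2 Y, sol Y & forall j : 'I_p, Y j.+1 = x 0 j) ->
  bvp_mult N f q w (Aexp gamma L) Bneg mu = \rank (kermx S).
Proof.
move=> pN solS solinj solsurj; rewrite /bvp_mult.
pose g (j : 'I_p) : 'I_N.+2 := inord j.+1.
have gE j : g j = j.+1 :> nat by rewrite inordK // ltnS (leq_trans (ltn_ord j)) ?leqW.
have mulG (y : 'rV[R[i]]_N.+2) : y *m colsub g 1%:M = \row_(j < p) y 0 (inord j.+1).
  by rewrite mulmx_colsub mulmx1; apply/rowP => j; rewrite !mxE.
apply: (mxrank_ker_iso (G := colsub g 1%:M)) => [y|y|x].
- by move=> /bvp_sysP /solS; rewrite mulG.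
- move=> /bvp_sysP ysol; rewrite mulG => /rowP yG; apply/rowP => k.
  rewrite [RHS]mxE -[k]inord_val; apply: (solinj _ ysol); last by rewrite -ltnS.
  move=> [//|j] /= jp; have := yG (Ordinal jp); by rewrite !mxE.
- move=> /solsurj[Y [b0 b1 eqs] Yx].
  have rowE k : (k <= N.+1)%N -> (\row_(j < N.+2) Y j) 0 (inord k) = Y k.
    by move=> kN; rewrite mxE inordK.
  exists (\row_(k < N.+2) Y k); last first.
    apply/rowP => j; rewrite mulG mxE rowE //.
    by rewrite (leq_trans (ltn_ord j)) // leqW.
  apply/bvp_sysP; split; rewrite ?rowE //.
  move=> k /[dup] kN /andP[k0 kN']; rewrite -[RHS](eqs _ kN) /bvp_eqn.
  have kN1 := leqW kN'; have kN2 := leq_trans (leq_pred k) kN1.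
  by rewrite !rowE.
Qed.

(** * The Hermitian pencil of a regular boundary condition *)

Lemma sum_ord_pick (V : nmodType) (n k : nat) (F : nat -> V) :
  \sum_(i < n) F i *+ (i == k :> nat) = if (k < n)%N then F k else 0.
Proof.
by rewrite -(big_ord1_eq +%R) [RHS]big_mkcond; apply: eq_bigr => i _; rewrite mulrb.
Qed.

(* [al], [be] and [g] carry the boundary condition; the indices are shifted by
   one, row [i] corresponding to [y_(i+1)]. *)
Definition periodic_jacobi (R : rcfType) (n : nat) (f q : nat -> R) (z : R[i])
    (al be g : R) : 'M[R[i]]_n.+2 :=
  \matrix_(i, j)
    ((q i.+1 + f i + f i.+1)%:C%C *+ (i == j)
     - (f i)%:C%C *+ (i == j.+1 :> nat) - (f j)%:C%C *+ (j == i.+1 :> nat)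
     + al%:C%C *+ ((i == 0%N :> nat) && (j == 0%N :> nat))
     + be%:C%C *+ ((i == n.+1 :> nat) && (j == n.+1 :> nat))
     - (g%:C%C * z^* ) *+ ((i == n.+1 :> nat) && (j == 0%N :> nat))
     - (g%:C%C * z) *+ ((i == 0%N :> nat) && (j == n.+1 :> nat))).

Lemma periodic_jacobi_hermitian (R : rcfType) (n : nat) (f q : nat -> R) (z : R[i])
    (al be g : R) :
  (periodic_jacobi n f q z al be g)^t* = periodic_jacobi n f q z al be g.
Proof.
apply/matrixP => i j; rewrite !mxE !(rmorphD, rmorphN, rmorphMn, rmorphM) /=.
rewrite !conjC_real_complex conjCK.
rewrite [(j == 0%N :> nat) && _]andbC [(j == n.+1 :> nat) && (i == n.+1 :> nat)]andbC.
rewrite [(j == n.+1 :> nat) && (i == 0%N :> nat)]andbC.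
rewrite [(j == 0%N :> nat) && (i == n.+1 :> nat)]andbC.
have -> : ((q j.+1)%:C%C + (f j)%:C%C + (f j.+1)%:C%C) *+ (j == i)
   = ((q i.+1)%:C%C + (f i)%:C%C + (f i.+1)%:C%C) *+ (i == j) :> R[i].
  by rewrite eq_sym; case: eqP => [->|].
ring.
Qed.

Definition wmx (R : rcfType) (n : nat) (w : nat -> R) : 'M[R[i]]_n :=
  diag_mx (\row_i (w i.+1)%:C%C).

(* The two bracketed terms vanish exactly when [Y] satisfies the boundary
   condition encoded by [al], [be] and [g]. *)
Lemma mul_periodic_pencil (R : rcfType) (n : nat) (f q w : nat -> R) (z : R[i])
    (al be g : R) (mu : R[i]) (Y : nat -> R[i]) (j : 'I_n.+2) :
  ((\row_(i < n.+2) Y i.+1) *m (periodic_jacobi n f q z al be g - mu *: wmx n.+2 w)) 0 j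
  = bvp_eqn f q w mu Y j.+1
    + ((f 0%N)%:C%C * Y 0%N + al%:C%C * Y 1%N - g%:C%C * z^* * Y n.+2) *+ (j == 0%N :> nat)
    + ((f n.+2)%:C%C * Y n.+3 + be%:C%C * Y n.+2 - g%:C%C * z * Y 1%N)
        *+ (j == n.+1 :> nat).
Proof.
rewrite mxE.
(* Every entry is a sum of Kronecker terms, so the product is evaluated term by term with
   [sum_ord_pick]; for [n = 0], where corners and off-diagonals overlap, nothing changes. *)
pose F0 k : R[i] := Y k.+1 * ((q k.+1 + f k + f k.+1)%:C%C - mu * (w k.+1)%:C%C).
pose F1 k : R[i] := Y k.+1 * (f k)%:C%C.
pose F2 k : R[i] := Y k.+1 * (f j)%:C%C.
pose Z0 k : R[i] := (Y k.+1 * al%:C%C) *+ (j == 0%N :> nat)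
  - (Y k.+1 * (g%:C%C * z)) *+ (j == n.+1 :> nat).
pose ZN k : R[i] := (Y k.+1 * be%:C%C) *+ (j == n.+1 :> nat)
  - (Y k.+1 * (g%:C%C * z^* )) *+ (j == 0%N :> nat).
transitivity (\sum_(i < n.+2) (F0 i *+ (i == j :> nat) - F1 i *+ (i == j.+1 :> nat)
    - (F2 i *+ (i == j.-1 :> nat)) *+ (0 < j)%N
    + Z0 i *+ (i == 0%N :> nat) + ZN i *+ (i == n.+1 :> nat))).
  apply: eq_bigr => i _; rewrite !mxE /F0 /F1 /F2 /Z0 /ZN.
  (* The guard [0 < j] is needed because [j.-1] is [0] for [j = 0]. *)
  have -> : (j == i.+1 :> nat) = ((i == j.-1 :> nat) && (0 < j)%N).
    by case: (nat_of_ord j) => [|k] /=; rewrite ?andbF // andbT eqSS eq_sym.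
  rewrite -val_eqE /=.
  rewrite -!mulnb !mulrnA.
  move: (i == j :> nat) (i == j.+1 :> nat) (i == j.-1 :> nat) (0 < j)%N
    (i == 0%N :> nat) (i == n.+1 :> nat) (j == 0%N :> nat) (j == n.+1 :> nat).
  move=> b1 b2 b3 b4 b5 b6 b7 b8.
  rewrite -(mulr_natr _ b1) -(mulr_natr _ b2) -(mulr_natr _ b3).
  rewrite -(mulr_natr _ b4) -(mulr_natr _ b5) -(mulr_natr _ b6).
  ring.
rewrite !big_split /= !sumrN sumrMnl !sum_ord_pick.
rewrite ltn_ord (leq_ltn_trans (leq_pred _) (ltn_ord j)) /= ltnSn.
rewrite /F0 /F1 /F2 /Z0 /ZN /bvp_eqn /=.
(* With [N = n.+2], the values $y_0$ and $y_{N+1}$ are not among the unknowns of the matrix; in the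
   first and last equations the leading term of the bracket cancels them. *)
have [jn|jn] := eqVneq (j : nat) n.+1.
  rewrite jn ltnn /= !mulr1n !mulr0n !rmorphD /=; ring.
have -> : (j.+1 < n.+2)%N.
  by have := ltn_ord j; rewrite ltnS leq_eqVlt (negPf jn).
have [j0|j0] := posnP j.
  rewrite j0 /= !mulr1n !mulr0n !rmorphD /=; ring.
rewrite prednK // !mulr1n !mulr0n !rmorphD /=; ring.
Qed.

(** * Boundary conditions *)

(** The first condition reads $y_N=z(cy_0+f_0k_{12}y_1)$ and is solved for $y_0$. After substitution
    in the second, the determinant condition reduces the coefficient of $y_1$ to $zf_0/c$, the
    conjugate of the coefficient of $y_N$ in the first when [zb] is the conjugate of [z] and the
    other data are real. *)
Lemma regular_boundary (F : fieldType) (k11 k12 k21 k22 f0 fN z zb y0 y1 yN yN1 : F)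
    (c := k11 - f0 * k12) :
  f0 != 0 -> c != 0 -> k11 * k22 - k12 * k21 = 1 -> z * zb = 1 ->
  (z * (k11 * y0 + k12 * (f0 * (y1 - y0))) = yN /\
   z * (k21 * y0 + k22 * (f0 * (y1 - y0))) = fN * (yN1 - yN)) <->
  (f0 * y0 + f0 ^+ 2 * k12 / c * y1 - f0 / c * zb * yN = 0 /\
   fN * yN1 + (- fN - (k21 - f0 * k22) / c) * yN - f0 / c * z * y1 = 0).
Proof.
move=> f0N0 cN0 det zzb.
have z0 : z != 0 by apply: contra_eq_neq zzb => ->; rewrite mul0r eq_sym oner_eq0.
have zbE : zb = z^-1 by rewrite -[RHS]mulr1 -zzb mulKf.
split=> [[<- e2]|[e1 e2]].
  split; first by rewrite zbE /c; field; rewrite z0.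
  (* The last summand is a multiple of [det K - 1]; adding it makes this a rational identity that
     [field] proves without the determinant condition. *)
  transitivity (fN * (yN1 - z * (k11 * y0 + k12 * (f0 * (y1 - y0))))
     - z * (k21 * y0 + k22 * (f0 * (y1 - y0)))
     + f0 * z * y1 / c * ((k11 * k22 - k12 * k21) - 1)).
    by rewrite /c; field.
  by rewrite -e2 det !subrr mulr0 addr0.
have yNE : yN = z * (c * y0 + f0 * k12 * y1).
  apply/eqP; rewrite -subr_eq0; apply/eqP.
  transitivity (- z * c / f0 * (f0 * y0 + f0 ^+ 2 * k12 / c * y1 - f0 / c * zb * yN)).
    by rewrite zbE; field; rewrite ?z0 ?f0N0 ?cN0.
  by rewrite e1 mulr0.
split; first by rewrite yNE /c; ring.
apply/eqP; rewrite -subr_eq0; apply/eqP.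
transitivity (- (fN * yN1 + (- fN - (k21 - f0 * k22) / c) * yN - f0 / c * z * y1)
   + f0 * z * y1 / c * ((k11 * k22 - k12 * k21) - 1)).
  by rewrite yNE /c; field.
by rewrite e2 det subrr mulr0 addr0 oppr0.
Qed.

(* The hypothesis relating [K] and [L] says that [L] has the same boundary form
   as [K] on the hyperplane [yN = z * l11 * y1]. *)
Lemma singular_boundary (F : fieldType)
    (k12 k21 k22 l11 l12 l21 l22 f0 fN z zb y0 y1 yN yN1 c : F) :
  f0 != 0 -> c != 0 -> l11 != 0 -> z * zb = 1 ->
  l11 = f0 * l12 -> l11 * l22 - l12 * l21 = 1 ->
  f0 ^+ 2 * k12 - 2 * f0 * l11 - l11 ^+ 2 * (k21 - f0 * k22) = - (c * l11 * l22 * f0) ->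
  (z * (l11 * y0 + l12 * (f0 * (y1 - y0))) = yN /\
   z * (l21 * y0 + l22 * (f0 * (y1 - y0))) = fN * (yN1 - yN)) <->
  (yN = z * l11 * y1 /\
   (f0 * y0 + f0 ^+ 2 * k12 / c * y1 - f0 / c * zb * yN)
   + zb * l11 * (fN * yN1 + (- fN - (k21 - f0 * k22) / c) * yN - f0 / c * z * y1) = 0).
Proof.
move=> f0N0 cN0 lN0 zzb lE det comp.
have z0 : z != 0 by apply: contra_eq_neq zzb => ->; rewrite mul0r eq_sym oner_eq0.
have zbE : zb = z^-1 by rewrite -[RHS]mulr1 -zzb mulKf.
(* Since [l11 = f0 * l12], the value [y0] cancels. *)
have bc1 : z * (l11 * y0 + l12 * (f0 * (y1 - y0))) = z * l11 * y1 by rewrite lE; ring.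
have l12E : l12 = l11 / f0 by rewrite lE; field.
have l21E : l21 = f0 * (l11 * l22 - 1) / l11.
  by rewrite -det l12E; field; rewrite lN0.
have k12E :
    k12 = (2 * f0 * l11 + l11 ^+ 2 * (k21 - f0 * k22) - c * l11 * l22 * f0) / f0 ^+ 2.
  rewrite -[LHS](mulfK (expf_neq0 2 f0N0)); congr (_ / _); apply/eqP.
  by rewrite -subr_eq0; apply/eqP; rewrite -(subrr (- (c * l11 * l22 * f0))) -{1}comp; ring.
(* On the hyperplane the combination is the residual of the second boundary equation times the
   nonzero factor [zb * l11]. *)
have bc2 : yN = z * l11 * y1 ->
   (f0 * y0 + f0 ^+ 2 * k12 / c * y1 - f0 / c * zb * yN)
   + zb * l11 * (fN * yN1 + (- fN - (k21 - f0 * k22) / c) * yN - f0 / c * z * y1)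
   = zb * l11 * (fN * (yN1 - yN) - z * (l21 * y0 + l22 * (f0 * (y1 - y0)))).
  by move=> ->; rewrite zbE l21E k12E; field; rewrite ?z0 ?f0N0 ?lN0 ?cN0.
rewrite bc1; split=> [[yNE e2]|[yNE]].
  by split=> //; rewrite bc2 // e2 subrr mulr0.
rewrite bc2 // => /eqP; rewrite !mulf_eq0 (negPf lN0) zbE invr_eq0 (negPf z0) /=.
by rewrite subr_eq0 => /eqP.
Qed.

(** * Compression to the hyperplane *)

(* Parametrizes the hyperplane [y_N = kap * y_1] by its other coordinates. *)
Definition attach_mx (R : rcfType) (n : nat) (kap : R[i]) : 'M[R[i]]_(n.+1, n.+2) :=
  \matrix_(i, j) ((i == j :> nat)%:R + kap *+ ((i == 0%N :> nat) && (j == n.+1 :> nat))).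

Lemma row_attach (R : rcfType) (n : nat) (kap : R[i]) (Y : nat -> R[i]) :
  Y n.+2 = kap * Y 1%N ->
  (\row_(i < n.+1) Y i.+1) *m attach_mx n kap = \row_(j < n.+2) Y j.+1.
Proof.
move=> YN; apply/rowP => j; rewrite !mxE.
transitivity (\sum_(i < n.+1) (Y i.+1 *+ (i == j :> nat)
     + (Y i.+1 * kap *+ (j == n.+1 :> nat)) *+ (i == 0%N :> nat))).
  apply: eq_bigr => i _; rewrite !mxE mulrDr mulr_natr -mulnb mulnC mulrnA.
  by rewrite !mulrnAr.
rewrite big_split /= (sum_ord_pick _ _ (fun k => Y k.+1)).
rewrite (sum_ord_pick _ _ (fun k => Y k.+1 * kap *+ (j == n.+1 :> nat))) /=.
have [->|jn] := eqVneq (j : nat) n.+1.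
  by rewrite ltnn add0r YN mulrC.
have -> : (j < n.+1)%N by have := ltn_ord j; rewrite ltnS leq_eqVlt (negPf jn).
by rewrite addr0.
Qed.

(** The adjoint of the parametrization folds the last equation, multiplied by the conjugate of
    [kap], onto the first. *)
Lemma mul_attach_trC (R : rcfType) (n : nat) (kap : R[i]) (x : 'rV[R[i]]_n.+2)
    (j : 'I_n.+1) :
  (x *m (attach_mx n kap)^t* ) 0 j =
  x 0 (widen_ord (leqnSn _) j) + (kap^* * x 0 ord_max) *+ (j == 0%N :> nat).
Proof.
rewrite mxE big_ord_recr /=; congr (_ + _).
  rewrite (bigD1 j) //= big1 ?addr0 => [|i ij]; rewrite !mxE /=.
    by rewrite eqxx (ltn_eqF (ltn_ord j)) andbF mulr0n addr0 rmorph1 mulr1.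
  by rewrite (ltn_eqF (ltn_ord i)) andbF mulr0n addr0 eq_sym val_eqE (negPf ij)
    rmorph0 mulr0.
rewrite !mxE /= eqxx andbT (ltn_eqF (ltn_ord j)) add0r rmorphMn /=.
by rewrite mulrnAr mulrC.
Qed.

(** The rows of [attach_mx] have disjoint supports, hence stay orthogonal for every diagonal weight;
    only the first one gains a term, $|\kappa|^2w_N$. *)
Lemma attach_wmx (R : rcfType) (n : nat) (kap : R[i]) (s : R) (w : nat -> R) :
  kap * kap^* = s%:C%C ->
  attach_mx n kap *m wmx n.+2 w *m (attach_mx n kap)^t* =
  diag_mx (\row_(i < n.+1) (w i.+1 + s * w n.+2 *+ (i == 0%N :> nat))%:C%C).
Proof.
move=> kapE; apply/row_matrixP => i; rewrite !row_mul; apply/rowP => j.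
rewrite mul_attach_trC /wmx mul_mx_diag !mxE /= eqxx andbT.
rewrite (ltn_eqF (ltn_ord j)) (ltn_eqF (ltn_ord i)) andbF mulr0n addr0 add0r val_eqE.
rewrite rmorphD rmorphMn rmorphM /= -kapE.
have [->|ij] := eqVneq i j.
  by case: (j == 0%N :> nat); rewrite ?mulr1n ?mulr0n; ring.
rewrite !mulr0n mul0r add0r.
case: (eqVneq (j : nat) 0%N) => j0; last by rewrite mulr0n.
by rewrite (_ : (i == 0%N :> nat) = false) ?mulr0n ?mul0r ?mulr0 ?mul0rn // -j0;
  apply: negPf.
Qed.

(** * Multiplicities as kernel dimensions *)

Lemma det_mx22 (A : comPzRingType) (M : 'M[A]_2) :
  \det M = M 0 0 * M 1 1 - M 0 1 * M 1 0.
Proof.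
have o1 : lift 0 0 = 1 :> 'I_2 by apply/val_inj.
have o0 : lift 1 0 = 0 :> 'I_2 by apply/val_inj.
rewrite (expand_det_row _ 0) !big_ord_recl big_ord0 addr0 /cofactor !det_mx11.
by rewrite !mxE /= o1 o0 expr0 expr1 mul1r mulN1r mulrN.
Qed.

Definition extend (C : Type) (N : nat) (yl yr : C) (Y : nat -> C) (k : nat) : C :=
  if k == 0%N then yl else if (k <= N)%N then Y k else yr.

Lemma expi_conj (R : realType) (gamma : R) (z := (cos gamma +i* sin gamma)%C) :
  z * z^* = 1.
Proof.
rewrite -[z^*]/(conjc z) /z /=; apply/eqP; rewrite eq_complex /=.
by rewrite mulrN opprK -!expr2 cos2Dsin2 eqxx mulrN mulrC addNr /=.
Qed.

(** By [regular_boundary] the boundary conditions are the vanishing of the two brackets in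
    [mul_periodic_pencil], which leaves the difference equations as the kernel equation. *)
Lemma bvp_mult_regular (R : realType) (n : nat) (f q w : nat -> R) (gamma : R)
    (K : 'M[R]_2) (mu : R[i]) (c := K 0 0 - f 0%N * K 0 1)
    (al := f 0%N ^+ 2 * K 0 1 / c)
    (be := - f n.+2 - (K 1 0 - f 0%N * K 1 1) / c)
    (z := (cos gamma +i* sin gamma)%C) :
  f 0%N != 0 -> f n.+2 != 0 -> \det K = 1 -> c != 0 ->
  bvp_mult n.+2 f q w (Aexp gamma K) Bneg mu =
  \rank (kermx (periodic_jacobi n f q z al be (f 0%N / c) - mu *: wmx n.+2 w)).
Proof.
move=> f0 fN; rewrite det_mx22 => detK c0.
have f0C : (f 0%N)%:C%C != 0 :> R[i] by rewrite (fmorph_eq0 (real_complex R)).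
have fNC : (f n.+2)%:C%C != 0 :> R[i] by rewrite (fmorph_eq0 (real_complex R)).
have cE : c%:C%C = (K 0 0)%:C%C - (f 0%N)%:C%C * (K 0 1)%:C%C :> R[i].
  by rewrite rmorphB rmorphM.
have cC : (K 0 0)%:C%C - (f 0%N)%:C%C * (K 0 1)%:C%C != 0 :> R[i].
  by rewrite -cE (fmorph_eq0 (real_complex R)).
have detC : (K 0 0)%:C%C * (K 1 1)%:C%C - (K 0 1)%:C%C * (K 1 0)%:C%C = 1 :> R[i].
  by rewrite -!rmorphM -rmorphB detK rmorph1.
have bc Y := regular_boundary (f n.+2)%:C%C (Y 0%N) (Y 1%N) (Y n.+2) (Y n.+3)
  f0C cC detC (expi_conj gamma).
have alE : al%:C%C = (f 0%N)%:C%C ^+ 2 * (K 0 1)%:C%C / c%:C%C :> R[i].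
  by rewrite -rmorphXn -rmorphM -fmorphV -rmorphM.
have beE : be%:C%C = - (f n.+2)%:C%C
    - ((K 1 0)%:C%C - (f 0%N)%:C%C * (K 1 1)%:C%C) / c%:C%C :> R[i].
  by rewrite rmorphB rmorphN rmorphM fmorphV rmorphB rmorphM.
have gE : (f 0%N / c)%:C%C = (f 0%N)%:C%C / c%:C%C :> R[i] by rewrite rmorphM fmorphV.
rewrite -cE -alE -beE -gE -/z in bc.
apply: bvp_mult_iso => // [Y [b0 b1 eqs]|Y [b0 b1 _] Y0|x xS].
- have [r0 r1] := (bc Y).1 (conj b0 b1).
  apply/rowP => j; rewrite mul_periodic_pencil r0 r1 !mul0rn !addr0 mxE.
  by rewrite eqs // ltn_ord.
- have := (bc Y).1 (conj b0 b1); rewrite (Y0 1%N) // (Y0 n.+2) ?leqnn //.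
  rewrite !mulr0 !subr0 !addr0 => -[/eqP + /eqP].
  rewrite !mulf_eq0 (negPf f0C) (negPf fNC) /= => /eqP y0 /eqP y1 [//|j].
  rewrite leq_eqVlt => /predU1P[[->] //|jN]; apply: Y0; exact: jN.
- pose X k := x 0 (inord k.-1).
  (* The end values are chosen to make the two brackets vanish. *)
  pose yl := - (al%:C%C * X 1%N - (f 0%N / c)%:C%C * z^* * X n.+2) / (f 0%N)%:C%C.
  pose yr := - (be%:C%C * X n.+2 - (f 0%N / c)%:C%C * z * X 1%N) / (f n.+2)%:C%C.
  pose Y := extend n.+2 yl yr X.
  have Yl : Y 0%N = yl by [].
  have Y1 : Y 1%N = X 1%N by [].
  have YN : Y n.+2 = X n.+2 by rewrite /Y /extend /= leqnn.
  have Yr : Y n.+3 = yr by rewrite /Y /extend /= ltnn.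
  have r0 : (f 0%N)%:C%C * Y 0%N + al%:C%C * Y 1%N - (f 0%N / c)%:C%C * z^* * Y n.+2 = 0.
    rewrite Y1 YN Yl mulrC divfK //; ring.
  have r1 : (f n.+2)%:C%C * Y n.+3 + be%:C%C * Y n.+2 - (f 0%N / c)%:C%C * z * Y 1%N = 0.
    rewrite Y1 YN Yr mulrC divfK //; ring.
  have Yx (j : 'I_n.+2) : Y j.+1 = x 0 j.
    by rewrite /Y /extend /= ltn_ord /X /= inord_val.
  exists Y => //; have [b0 b1] := (bc Y).2 (conj r0 r1); split => // -[//|k] /= kN.
  have /rowP/(_ (Ordinal (kN : (k < n.+2)%N))) := xS.
  have -> : x = \row_(j < n.+2) Y j.+1 by apply/rowP => j; rewrite mxE Yx.
  by rewrite mul_periodic_pencil r0 r1 !mul0rn !addr0 mxE.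
Qed.

(** Here the boundary conditions no longer determine $y_0$ and $y_{N+1}$ from $y_1$ and $y_N$; the
    first and last difference equations do. What remains of the boundary conditions is the
    hyperplane and the single combination that appears in the first compressed equation. *)
Lemma bvp_mult_singular (R : realType) (n : nat) (f q w : nat -> R) (gamma : R)
    (K L : 'M[R]_2) (mu : R[i]) (c := K 0 0 - f 0%N * K 0 1)
    (al := f 0%N ^+ 2 * K 0 1 / c)
    (be := - f n.+2 - (K 1 0 - f 0%N * K 1 1) / c)
    (z := (cos gamma +i* sin gamma)%C)
    (V := attach_mx n (z * (L 0 0)%:C%C)) :
  f 0%N != 0 -> f n.+2 != 0 -> c != 0 ->
  L 0 0 != 0 -> L 0 0 = f 0%N * L 0 1 -> \det L = 1 ->
  f 0%N ^+ 2 * K 0 1 - 2 * f 0%N * L 0 0 - L 0 0 ^+ 2 * (K 1 0 - f 0%N * K 1 1)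
    = - (c * L 0 0 * L 1 1 * f 0%N) ->
  bvp_mult n.+2 f q w (Aexp gamma L) Bneg mu =
  \rank (kermx (V *m (periodic_jacobi n f q z al be (f 0%N / c) - mu *: wmx n.+2 w)
                 *m V^t* )).
Proof.
move=> f0 fN c0 L0 LE; rewrite det_mx22 => detL comp.
have f0C : (f 0%N)%:C%C != 0 :> R[i] by rewrite (fmorph_eq0 (real_complex R)).
have fNC : (f n.+2)%:C%C != 0 :> R[i] by rewrite (fmorph_eq0 (real_complex R)).
have cC : c%:C%C != 0 :> R[i] by rewrite (fmorph_eq0 (real_complex R)).
have LC : (L 0 0)%:C%C != 0 :> R[i] by rewrite (fmorph_eq0 (real_complex R)).
have LEC : (L 0 0)%:C%C = (f 0%N)%:C%C * (L 0 1)%:C%C :> R[i].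
  by rewrite -rmorphM -LE.
have detC : (L 0 0)%:C%C * (L 1 1)%:C%C - (L 0 1)%:C%C * (L 1 0)%:C%C = 1 :> R[i].
  by rewrite -!rmorphM -rmorphB detL rmorph1.
have compC := congr1 (real_complex R) comp.
rewrite !(rmorphB, rmorphN, rmorphM, rmorph_nat) /= in compC.
have cE : c%:C%C = (K 0 0)%:C%C - (f 0%N)%:C%C * (K 0 1)%:C%C :> R[i].
  by rewrite rmorphB rmorphM.
rewrite -cE -!expr2 in compC.
have bc Y := singular_boundary (f n.+2)%:C%C (Y 0%N) (Y 1%N) (Y n.+2) (Y n.+3)
  f0C cC LC (expi_conj gamma) LEC detC compC.
have alE : al%:C%C = (f 0%N)%:C%C ^+ 2 * (K 0 1)%:C%C / c%:C%C :> R[i].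
  by rewrite -rmorphXn -rmorphM -fmorphV -rmorphM.
have beE : be%:C%C = - (f n.+2)%:C%C
    - ((K 1 0)%:C%C - (f 0%N)%:C%C * (K 1 1)%:C%C) / c%:C%C :> R[i].
  by rewrite rmorphB rmorphN rmorphM fmorphV rmorphB rmorphM.
have gE : (f 0%N / c)%:C%C = (f 0%N)%:C%C / c%:C%C :> R[i] by rewrite rmorphM fmorphV.
rewrite -alE -beE -gE -/z in bc.
have zconj : (z * (L 0 0)%:C%C)^* = z^* * (L 0 0)%:C%C.
  by rewrite rmorphM /= conjC_real_complex.
apply: bvp_mult_iso => // [Y [b0 b1 eqs]|Y [b0 b1 eqs] Y0|x xS].
- have [YN r] := (bc Y).1 (conj b0 b1).
  rewrite !mulmxA row_attach //; apply/rowP => j; rewrite mul_attach_trC.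
  rewrite !mul_periodic_pencil /= eqxx zconj mxE !eqs ?ltnSn ?(leqW (ltn_ord j)) //.
  rewrite (ltn_eqF (ltn_ord j)) !mulr0n mulr1n !(add0r, addr0).
  by rewrite -mulrnDl r mul0rn.
(* The constraint gives $y_N=0$ from $y_1=0$; the difference equations at [1] and [N] then give
   $y_0=y_{N+1}=0$. *)
- have [yNE _] := (bc Y).1 (conj b0 b1).
  have YN : Y n.+2 = 0 by rewrite yNE (Y0 1%N) // mulr0.
  have YZ k : (0 < k <= n.+2)%N -> Y k = 0.
    move=> /andP[k0]; rewrite leq_eqVlt => /predU1P[-> //|kn].
    by apply: Y0; rewrite k0.
  have := eqs 1%N isT; rewrite /bvp_eqn /= !(YZ 1%N, YZ 2%N) //.
  rewrite !(mulr0, subr0, sub0r, addr0, add0r, mulrN, opprK) => /eqP.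
  rewrite oppr_eq0 mulf_eq0 (negPf f0C) => /eqP y0.
  have := eqs n.+2; rewrite /bvp_eqn /= leqnn !(YZ n.+2, YZ n.+1) ?leqnn ?leqnSn //.
  rewrite !(mulr0, subr0, sub0r, addr0) => /(_ isT) /eqP.
  rewrite oppr_eq0 mulf_eq0 (negPf fNC) => /eqP y1 [//|j].
  rewrite leq_eqVlt => /predU1P[[->] //|jN]; exact: YZ.
(* The row [x] is continued by the constraint at [N]; [yl] and [yr] solve the difference equations
   at [1] and [N]. *)
- pose X k := if (k <= n.+1)%N then x 0 (inord k.-1) else z * (L 0 0)%:C%C * x 0 0.
  pose yl := X 1%N - ((f 1%N)%:C%C * (X 2%N - X 1%N) - (q 1%N)%:C%C * X 1%N
                     + mu * (w 1%N)%:C%C * X 1%N) / (f 0%N)%:C%C.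
  pose yr := X n.+2 + ((f n.+1)%:C%C * (X n.+2 - X n.+1) + (q n.+2)%:C%C * X n.+2
                     - mu * (w n.+2)%:C%C * X n.+2) / (f n.+2)%:C%C.
  pose Y := extend n.+2 yl yr X.
  have YX k : (0 < k <= n.+2)%N -> Y k = X k.
    by case: k => // k /= kn; rewrite /Y /extend /= kn.
  have Yl : Y 0%N = yl by [].
  have Yr : Y n.+3 = yr by rewrite /Y /extend /= ltnn.
  have Yx (j : 'I_n.+1) : Y j.+1 = x 0 j.
    rewrite YX; last by rewrite /= (leqW (ltn_ord j)).
    by rewrite /X ltn_ord /= inord_val.
  have YN : Y n.+2 = z * (L 0 0)%:C%C * Y 1%N.
    by rewrite (Yx 0) YX ?leqnn // /X ltnn.
  have e1 : bvp_eqn f q w mu Y 1 = 0.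
    by rewrite /bvp_eqn /= !(YX 1%N, YX 2%N) // Yl /yl; field.
  have eN : bvp_eqn f q w mu Y n.+2 = 0.
    rewrite /bvp_eqn /= Yr !(YX n.+1, YX n.+2) ?leqnn ?leqnSn // /yr; by field.
  have xY : x *m V = \row_(j < n.+2) Y j.+1.
    by rewrite -(row_attach YN); congr (_ *m _); apply/rowP => j; rewrite mxE Yx.
  rewrite !mulmxA xY in xS.
  have ent (j : 'I_n.+1) := congr1 (fun m : 'rV_n.+1 => m 0 j) xS.
  (* With both end equations satisfied, entry [0] of the kernel equation is exactly the second
     condition of [singular_boundary]. *)
  have r : ((f 0%N)%:C%C * Y 0%N + al%:C%C * Y 1%N - (f 0%N / c)%:C%C * z^* * Y n.+2)
      + z^* * (L 0 0)%:C%C * ((f n.+2)%:C%C * Y n.+3 + be%:C%C * Y n.+2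
                              - (f 0%N / c)%:C%C * z * Y 1%N) = 0.
    have := ent 0; rewrite /= mul_attach_trC !mul_periodic_pencil /= e1 eN eqxx.
    by rewrite zconj mulr1n !mulr0n !(add0r, addr0) mulr1n mxE.
  exists Y => //; have [b0 b1] := (bc Y).2 (conj YN r); split=> // -[//|k] /= kN.
  have [->|k0] := posnP k; first exact: e1.
  move: kN; rewrite leq_eqVlt => /predU1P[-> //|kn].
  have := ent (Ordinal (kn : (k < n.+1)%N)).
  rewrite mul_attach_trC !mul_periodic_pencil /= (gtn_eqF k0) (ltn_eqF (kn : (k < n.+1)%N)).
  by rewrite !mulr0n !addr0 mxE.
Qed.

(** * Interlacing of the spectra *)

(** If [Q] diagonalizes the compressed pencil, the rows of [Q *m V] are [n.+1] vectors of the full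
    space, orthonormal for the full weight, so they can be compared with the rows of [P]. *)
Lemma singular_interlacing (R : realType) (n : nat) (f q w : nat -> R) (gamma : R)
    (K L : 'M[R]_2) (c := K 0 0 - f 0%N * K 0 1)
    (A := periodic_jacobi n f q (cos gamma +i* sin gamma)%C
            (f 0%N ^+ 2 * K 0 1 / c)
            (- f n.+2 - (K 1 0 - f 0%N * K 1 1) / c) (f 0%N / c))
    (lam : n.+2.-tuple R) (P : 'M[R[i]]_n.+2) :
  f 0%N != 0 -> f n.+2 != 0 -> (forall k, (0 < k <= n.+2)%N -> 0 < w k) -> c != 0 ->
  L 0 0 != 0 -> L 0 0 = f 0%N * L 0 1 -> \det L = 1 ->
  f 0%N ^+ 2 * K 0 1 - 2 * f 0%N * L 0 0 - L 0 0 ^+ 2 * (K 1 0 - f 0%N * K 1 1)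
    = - (c * L 0 0 * L 1 1 * f 0%N) ->
  sorted <=%R lam -> P *m wmx n.+2 w *m P^t* = 1%:M ->
  P *m A *m P^t* = diag_mx (\row_i (tnth lam i)%:C%C) ->
  exists lamL : seq R,
    [/\ size lamL = n.+1,
        bvp_spectrum n.+2 f q w (Aexp gamma L) Bneg lamL &
        forall k, (k <= n)%N -> lam`_k <= lamL`_k /\ lamL`_k <= lam`_k.+1].
Proof.
move=> f0 fN w0 c0 L0 LE detL comp slam PW PA.
set z := (cos gamma +i* sin gamma)%C in A PA.
pose V := attach_mx n (z * (L 0 0)%:C%C).
have zL : z * (L 0 0)%:C%C * (z * (L 0 0)%:C%C)^* = (L 0 0 ^+ 2)%:C%C.
  rewrite rmorphM /= conjC_real_complex mulrACA expi_conj mul1r.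
  by rewrite -rmorphM expr2.
pose wV (i : 'I_n.+1) := w i.+1 + L 0 0 ^+ 2 * w n.+2 *+ (i == 0%N :> nat).
have wV0 i : 0 < wV i.
  rewrite ltr_wpDr ?w0 ?(leqW (ltn_ord i)) // mulrn_wge0 // mulr_ge0 ?sqr_ge0 //.
  by rewrite ltW // w0 //= leqnn.
have VAV : (V *m A *m V^t* )^t* = V *m A *m V^t*.
  by rewrite !mulmx_trC trmxCK periodic_jacobi_hermitian mulmxA.
have [lamL [Q [slamL QW QA]]] := hermitian_pair_diagonalization wV0 VAV.
rewrite -(attach_wmx n w zL) -/V in QW.
have QVW : (Q *m V) *m wmx n.+2 w *m (Q *m V)^t* = 1%:M.
  by rewrite mulmx_trC -QW !mulmxA.
have QVA : (Q *m V) *m A *m (Q *m V)^t* = diag_mx (\row_i (tnth lamL i)%:C%C).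
  by rewrite mulmx_trC -QA !mulmxA.
exists lamL; split.
- by rewrite size_tuple.
- split=> // mu; rewrite (bvp_mult_singular q w gamma mu f0 fN c0) // -/z -/V -/A.
  rewrite mulmxBr mulmxBl -scalemxAr -scalemxAl.
  exact: mxrank_ker_pencil QW QA.
(* The dimension counts are $(n+2)+k<(k+1)+(n+2)$ and $(n+2)+k<(k+2)+(n+1)$; the second is tight,
   which accounts for the index shift. *)
- move=> k kn; split.
    apply: (eigenvalue_crossing slamL slam QVW PW QVA PA) => //.
      exact: leqW.
    by rewrite addnC !addSn !addnS.
  apply: (eigenvalue_crossing slam slamL PW QVW PA QVA) => //.
  by rewrite addnC !addSn !addnS.
Qed.

Theorem theorem3p12 (R : realType) (N : nat) (f q w : nat -> R)
  (gamma : R) (K : 'M[R]_2) :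
  (2 <= N)%N ->
  (forall n, (n <= N)%N -> f n != 0) ->
  (forall n, (1 <= n <= N)%N -> 0 < w n) ->
  - pi < gamma <= pi ->
  \det K = 1 ->
  K 0 0 - f 0%N * K 0 1 != 0 ->
  exists lamK : seq R,
    [/\ size lamK = N,
        bvp_spectrum N f q w (Aexp gamma K) Bneg lamK,
        (K 0 0 != 0 ->
          exists lamH : seq R,
            [/\ size lamH = N.-1,
                bvp_spectrum N f q w (Aexp gamma (Khat (f 0%N) K)) Bneg lamH &
                forall n, (n <= N - 2)%N ->
                  lamK`_n <= lamH`_n /\ lamH`_n <= lamK`_n.+1]) &
        (K 0 1 != 0 ->
          exists lamT : seq R,
            [/\ size lamT = N.-1,
                bvp_spectrum N f q w (Aexp gamma (Ktilde (f 0%N) K)) Bneg lamT &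
                forall n, (n <= N - 2)%N ->
                  lamK`_n <= lamT`_n /\ lamT`_n <= lamK`_n.+1])].
Proof.
case: N => [|[|n]] // _ fN0 w0 _ detK c0.
have f0 := fN0 0%N isT; have fN := fN0 _ (leqnn _).
have wi (i : 'I_n.+2) : 0 < w i.+1 by rewrite w0 //= ltn_ord.
have [lam [P [slam PW PA]]] :=
  hermitian_pair_diagonalization wi (periodic_jacobi_hermitian n f q
    (cos gamma +i* sin gamma)%C (f 0%N ^+ 2 * K 0 1 / (K 0 0 - f 0%N * K 0 1))
    (- f n.+2 - (K 1 0 - f 0%N * K 1 1) / (K 0 0 - f 0%N * K 0 1))
    (f 0%N / (K 0 0 - f 0%N * K 0 1))).
have detK2 : K 0 0 * K 1 1 = 1 + K 0 1 * K 1 0.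
  by apply/eqP; rewrite -subr_eq -det_mx22 detK.
exists lam; split; first by rewrite size_tuple.
- split=> // mu; rewrite (bvp_mult_regular q w gamma mu f0 fN detK c0).
  exact: mxrank_ker_pencil PW PA.
- move=> k0; rewrite subn2 /=.
  apply: (singular_interlacing (K := K) (L := Khat (f 0%N) K) (P := P)) => //;
    rewrite ?det_mx22 ?mxE //=.
  + by field.
  + by field; rewrite f0.
  (* The two sides of the compatibility relation differ by a multiple of [det K - 1]; the same holds
     for [Ktilde] below. *)
  + transitivity (- ((K 0 0 - f 0%N * K 0 1) * (f 0%N + K 0 0 * K 1 0))
      + f 0%N * K 0 0 * (K 0 0 * K 1 1 - (1 + K 0 1 * K 1 0))); first by ring.
    by rewrite detK2 subrr mulr0 addr0; field; rewrite f0.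
- move=> k0; rewrite subn2 /=.
  have fk0 : f 0%N * K 0 1 != 0 by rewrite mulf_neq0.
  apply: (singular_interlacing (K := K) (L := Ktilde (f 0%N) K) (P := P)) => //;
    rewrite ?det_mx22 ?mxE //=.
  + by field.
  + transitivity (- ((K 0 0 - f 0%N * K 0 1) * (f 0%N * K 0 1) * K 1 1 * f 0%N)
      + f 0%N ^+ 2 * K 0 1 * (K 0 0 * K 1 1 - (1 + K 0 1 * K 1 0))); first by ring.
    by rewrite detK2 subrr mulr0 addr0.
Qed.
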